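(* Let $(G_n)$ be a family of regular graphs, where $G_n$ has $n$ vertices and $n$ ranges over an infinite set of positive integers, such that $G_n$ and its complement $\overline{G_n}$ are both connected (the degree of $G_n$ may depend on $n$ arbitrarily). Then \[ \mathcal{K}(G_n)\,\mathcal{K}(\overline{G_n}) = O(n^3). \]
   Context: Graphs are finite, simple, undirected and unweighted. $\overline{G}$ is the complement of $G$. For a connected graph $G$ with vertex set $\{1,\dots,n\}$, $m$ edges and vertex degrees $d_1,\dots,d_n$, Kemeny's constant is $\mathcal{K}(G)=\sum_{j\neq i}\frac{d_j}{2m}\,m_{i,j}$, where $m_{i,j}$ is the expected first time at which the simple random walk on $G$ (which moves at each step to a uniformly random neighbour) started at $i$ reaches $j$; this value does not depend on the choice of $i$. Asymptotic notation: $f(G_n)=O(g(n))$ means $\limsup_{n\to\infty} f(G_n)/g(n)$ is finite. *)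

(* Defs.v *)
From HB Require Import structures.
From mathcomp Require Import all_boot all_order all_algebra.
From mathcomp Require Import all_classical all_reals all_analysis.

Set Implicit Arguments.
Unset Strict Implicit.
Unset Printing Implicit Defensive.

Import Order.TTheory GRing.Theory Num.Theory.

Local Open Scope ring_scope.

Record sgraph (T : finType) := SGraph {
  adj : rel T;
  adj_sym : symmetric adj;
  adj_irr : irreflexive adj }.

Section Graphs.
Variable T : finType.
Implicit Type G : sgraph T.

Definition compl_adj G : rel T := fun x y => (x != y) && ~~ adj G x y.

Fact compl_adj_sym G : symmetric (compl_adj G).
Proof. by move=> x y; rewrite /compl_adj eq_sym adj_sym. Qed.

Fact compl_adj_irr G : irreflexive (compl_adj G).
Proof. by move=> x; rewrite /compl_adj eqxx. Qed.

Definition complement G : sgraph T :=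
  SGraph (compl_adj_sym G) (compl_adj_irr G).

Definition degree G (x : T) : nat := #|[set y | adj G x y]|.

Definition edges G : {set {set T}} :=
  [set [set p.1; p.2] | p in [set p : T * T | adj G p.1 p.2]].

Definition regular_graph G : Prop := exists d, forall x, degree G x = d.

Definition connected_graph G : Prop :=
  (0 < #|T|)%N /\ forall x y, connect (adj G) x y.

End Graphs.

Section RandomWalk.
Variables (R : realType) (T : finType).
Implicit Types (G : sgraph T) (i j : T).

Definition step_prob G (x y : T) : R := (adj G x y)%:R / (degree G x)%:R.

(* Probability that the walk started at x has w as its sequence of first
   size w positions after x. *)
Fixpoint traj_prob G (x : T) (w : seq T) : R :=
  if w is y :: w' then step_prob G x y * traj_prob G y w' else 1.

(* P_i(tau_j = k), where tau_j = min {t >= 0 | X_t = j}.  The positions at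
   times 0, ..., k are i :: w, and index j (i :: w) is the first time at which
   j occurs among them (it is k.+1 if j does not occur). *)
Definition hit_prob G i j (k : nat) : R :=
  \sum_(w : k.-tuple T | index j (i :: w) == k) traj_prob G i w.

(* E_i[tau_j], including the contribution of the event tau_j = +oo; recall that
   +oo * 0 = 0 in \bar R. *)
Definition mean_hit_time G i j : \bar R :=
  (\sum_(0 <= k <oo) (k%:R * hit_prob G i j k)%:E
   + +oo * (1 - \sum_(0 <= k <oo) (hit_prob G i j k)%:E))%E.

Definition kemeny_from G i : \bar R :=
  (\sum_(j | j != i)
     ((degree G j)%:R / (2 * #|edges G|)%:R)%:E * mean_hit_time G i j)%E.

(* For a connected graph the value of kemeny_from G i does not depend on i, so
   any start vertex may be picked. *)
Definition kemeny G : \bar R :=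
  if [pick i : T] is Some i then kemeny_from G i else 0%E.

End RandomWalk.

Arguments kemeny R {T} G.

(* f(n) = O(g(n)) as n tends to infinity within N. *)
Definition bigO_along (R : realType) (N : set nat)
    (f : nat -> \bar R) (g : nat -> R) : Prop :=
  limf_esup (fun n => f n * ((g n)^-1)%:E)%E (within N \oo)%classic \is a fin_num.

(* Main.v *)
Require Import Defs.
From HB Require Import structures.
From mathcomp Require Import all_boot all_order all_algebra.
From mathcomp Require Import all_classical all_reals all_analysis.
From mathcomp Require Import zify lra ring.

Set Implicit Arguments.
Unset Strict Implicit.
Unset Printing Implicit Defensive.

Import Order.TTheory GRing.Theory Num.Theory.
Import numFieldNormedType.Exports.

Local Open Scope classical_set_scope.
Local Open Scope ring_scope.

(** Kemeny's constant is a weighted average of mean hitting times, so it is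
    enough to bound these uniformly.  This is done by an energy argument.

    Let h(x) be the mean time to hit j from x in a connected d-regular graph on
    n vertices.  Away from j the Laplacian L of the graph satisfies L h = d, and
    h(j) = 0, hence <h, L h> = d * sum h <= d n M, where M = max h.  If every
    effective resistance is at most r, then M^2 <= r <h, L h>, and therefore
    M <= r d n ([subsolution_le]).  The argument only uses L h <= d, so it
    applies to the truncated times E_x[min(tau_j, K)]; the bound being uniform
    in K, it passes to the limit ([mean_hit_time_bound]).

    Two resistance bounds are used.  In any connected d-regular graph a shortest
    path has O(n / d) edges, because a vertex has at most three neighbours on
    it; thus r = O(n / d), and the constant is O(n^2) ([resistance_path]).
    For a pair of complementary regular graphs of degrees d and e = n - 1 - d,
    suppose 2 d < n.  The Laplacians add up to that of the complete graph, whose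
    nonzero eigenvalues are all n, and that of the sparser graph is at most 2 d.
    So the denser one has a spectral gap of at least n - 2 d >= 1.  Since its
    degree is large, this weak gap already gives r = O(1 / e), and its constant
    is O(n) ([poincare_complementary], [resistance_dense]).  The product of the
    two constants is O(n^3). *)

(** * Dirichlet energy and effective resistance *)

Section Energy.
Variable R : realType.
Implicit Types (T : finType).

Lemma sum_sqr_pairs T (f : T -> R) :
  \sum_x \sum_y (f x - f y) ^+ 2
  = 2 * #|T|%:R * (\sum_x f x ^+ 2) - 2 * (\sum_x f x) ^+ 2.
Proof.
have inner x : \sum_y (f x - f y) ^+ 2
    = #|T|%:R * f x ^+ 2 - 2 * f x * (\sum_y f y) + \sum_y f y ^+ 2.
  under eq_bigr do rewrite sqrrB.
  rewrite big_split /= sumrB sumr_const mulr_natl; congr (_ - _ + _).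
  by rewrite mulr_sumr; apply: eq_bigr => y _; ring.
under eq_bigr do rewrite inner.
rewrite big_split /= sumrB -mulr_sumr sumr_const -[X in _ + X]mulr_natl.
rewrite -mulr_suml -mulr_sumr; ring.
Qed.

(** Cauchy-Schwarz against the constant function: the defect is half the
    left-hand side of [sum_sqr_pairs]. *)
Lemma sqr_sum_le (l : nat) (f : 'I_l -> R) :
  (\sum_i f i) ^+ 2 <= l%:R * \sum_i f i ^+ 2.
Proof.
have : 0 <= \sum_x \sum_y (f x - f y) ^+ 2.
  by do 2!(apply: sumr_ge0 => ? _); apply: sqr_ge0.
by rewrite sum_sqr_pairs card_ord; lra.
Qed.

(** Every edge is counted in both directions, so this is twice the usual
    Dirichlet energy. *)
Definition energy T (G : sgraph T) (f : T -> R) : R :=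
  \sum_x \sum_(y | adj G x y) (f x - f y) ^+ 2.

Lemma energy_ge0 T (G : sgraph T) f : 0 <= energy G f.
Proof. by do 2!(apply: sumr_ge0 => ? _); apply: sqr_ge0. Qed.

Lemma sum_nbr_const T (G : sgraph T) x (c : R) :
  \sum_(y | adj G x y) c = (degree G x)%:R * c.
Proof. by rewrite sumr_const mulr_natl /degree cardsE. Qed.

Lemma exchange_nbr T (G : sgraph T) (F : T -> T -> R) :
  \sum_x \sum_(y | adj G x y) F x y = \sum_x \sum_(y | adj G x y) F y x.
Proof.
rewrite (exchange_big_dep xpredT) //=.
by apply: eq_bigr => y _; apply: eq_bigl => x; rewrite adj_sym.
Qed.

Lemma sum_nbr_sqr T (G : sgraph T) (f : T -> R) d :
  (forall x, degree G x = d) ->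
  \sum_x \sum_(y | adj G x y) f y ^+ 2 = d%:R * \sum_x f x ^+ 2.
Proof.
move=> deg; rewrite exchange_nbr mulr_sumr.
by apply: eq_bigr => x _; rewrite sum_nbr_const deg.
Qed.

(** Summation by parts: the energy is 2 <f, L f> for the Laplacian L. *)
Lemma energy_laplacian T (G : sgraph T) (f : T -> R) d :
  (forall x, degree G x = d) ->
  energy G f = 2 * \sum_x f x * (d%:R * f x - \sum_(y | adj G x y) f y).
Proof.
move=> deg.
have -> : energy G f = \sum_x \sum_(y | adj G x y) f x ^+ 2
    - 2 * (\sum_x \sum_(y | adj G x y) f x * f y)
    + \sum_x \sum_(y | adj G x y) f y ^+ 2.
  rewrite mulr_sumr -sumrB -big_split; apply: eq_bigr => x _ /=.
  rewrite mulr_sumr -sumrB -big_split; apply: eq_bigr => y _ /=; ring.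
under [in RHS]eq_bigr do rewrite mulrBr.
rewrite sumrB (sum_nbr_sqr f deg).
under eq_bigr do rewrite sum_nbr_const deg.
rewrite -mulr_sumr.
have -> : \sum_x f x * (d%:R * f x) = d%:R * \sum_x f x ^+ 2.
  by rewrite mulr_sumr; apply: eq_bigr => x _; ring.
under [X in _ = 2 * (_ - X)]eq_bigr do rewrite mulr_sumr.
ring.
Qed.

(** The third hypothesis says that L f <= d away from the target j, which is
    what hitting times of j satisfy, with equality.  As f >= 0 and f j = 0,
    it bounds <f, L f> by d times the sum of f. *)
Lemma energy_subsolution T (G : sgraph T) (f : T -> R) d j :
  (forall x, degree G x = d) ->
  f j = 0 -> (forall x, 0 <= f x) ->
  (forall x, x != j -> d%:R * f x <= d%:R + \sum_(y | adj G x y) f y) ->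
  energy G f <= 2 * d%:R * \sum_x f x.
Proof.
move=> deg fj f0 fsub; rewrite (energy_laplacian _ deg) -mulrA ler_pM2l //.
rewrite mulr_sumr; apply: ler_sum => x _.
have [->|xj] := eqVneq x j; first by rewrite fj mul0r mulr0.
by rewrite mulrC ler_wpM2r // lerBlDr fsub.
Qed.

(** By the Dirichlet principle, this says that all effective resistances of G
    are at most 2 c; the 2 comes from the normalization of [energy]. *)
Definition resistance_le T (G : sgraph T) (c : R) : Prop :=
  forall (f : T -> R) i j, f j = 0 -> f i ^+ 2 <= c * energy G f.

(** At a maximum point m, resistance and energy give
    f(m)^2 <= c * energy <= 2 c d * sum f <= 2 c d |T| * f(m);
    one factor f(m) cancels. *)
Lemma subsolution_le T (G : sgraph T) (f : T -> R) d j c :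
  (forall x, degree G x = d) -> 0 <= c -> resistance_le G c ->
  f j = 0 -> (forall x, 0 <= f x) ->
  (forall x, x != j -> d%:R * f x <= d%:R + \sum_(y | adj G x y) f y) ->
  forall x, f x <= 2 * c * d%:R * #|T|%:R.
Proof.
move=> deg c0 Gc fj f0 fsub.
have [m _ maxm] := @arg_maxP _ _ _ j xpredT f isT.
move=> x; apply: le_trans (maxm x isT) _.
have sumle : \sum_x f x <= #|T|%:R * f m.
  rewrite mulr_natl -sumr_const; apply: ler_sum => y _; exact: maxm.
have : f m ^+ 2 <= 2 * c * d%:R * #|T|%:R * f m.
  apply: le_trans (Gc f m j fj) _.
  have := energy_subsolution deg fj f0 fsub => e_le.
  have -> : 2 * c * d%:R * #|T|%:R * f m = c * (2 * d%:R * (#|T|%:R * f m)).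
    by ring.
  rewrite ler_wpM2l //; apply: le_trans e_le _.
  by rewrite ler_wpM2l // mulr_ge0.
have [-> _|fm0] := eqVneq (f m) 0; first by rewrite !mulr_ge0.
by rewrite expr2 ler_pM2r // lt_neqAle eq_sym fm0 f0.
Qed.

Lemma energy_le_regular T (G : sgraph T) (f : T -> R) d :
  (forall x, degree G x = d) -> energy G f <= 4 * d%:R * \sum_x f x ^+ 2.
Proof.
move=> deg.
have : energy G f <= \sum_x \sum_(y | adj G x y) (2 * f x ^+ 2 + 2 * f y ^+ 2).
  apply: ler_sum => x _; apply: ler_sum => y _.
  by have := sqr_ge0 (f x + f y); lra.
move=> /le_trans; apply.
have -> : \sum_x \sum_(y | adj G x y) (2 * f x ^+ 2 + 2 * f y ^+ 2)
    = 2 * (\sum_x \sum_(y | adj G x y) f x ^+ 2)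
      + 2 * \sum_x \sum_(y | adj G x y) f y ^+ 2.
  rewrite !mulr_sumr -big_split; apply: eq_bigr => x _ /=.
  by rewrite !mulr_sumr -big_split.
by rewrite exchange_nbr (sum_nbr_sqr f deg); lra.
Qed.

(** A symmetric stand-in for H = complement G, which lets the two graphs
    exchange roles: the complement of the complement is G only up to
    equality of the adjacency relations. *)
Definition complementary T (G H : sgraph T) :=
  forall x y, adj H x y = (x != y) && ~~ adj G x y.

(** Every pair x != y is an edge of exactly one of the two graphs, so the
    energies add up to that of the complete graph. *)
Lemma energy_complementary T (G H : sgraph T) f :
  complementary G H ->
  energy G f + energy H f
  = 2 * #|T|%:R * (\sum_x f x ^+ 2) - 2 * (\sum_x f x) ^+ 2.
Proof.
move=> GH; rewrite -sum_sqr_pairs -big_split; apply: eq_bigr => x _ /=.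
rewrite [RHS](bigID (adj G x)) /=; congr (_ + _).
rewrite [RHS](bigD1 x) ?adj_irr //= subrr expr0n add0r.
by apply: eq_bigl => y; rewrite GH eq_sym andbC.
Qed.

(** A spectral gap of at least 1 for H.  The complete graph has gap |T|, and the
    Laplacian of the d-regular graph G is at most 2 d, so that H is left with
    |T| - 2 d >= 1. *)
Lemma poincare_complementary T (G H : sgraph T) d f :
  complementary G H -> (forall x, degree G x = d) -> (2 * d < #|T|)%N ->
  \sum_x f x = 0 -> 2 * \sum_x f x ^+ 2 <= energy H f.
Proof.
move=> GH deg small f0.
have := energy_complementary f GH; have := energy_le_regular f deg.
rewrite f0.
have : (2 * d%:R + 1) * \sum_x f x ^+ 2 <= #|T|%:R * \sum_x f x ^+ 2.
  rewrite ler_wpM2r ?sumr_ge0 // => [x _|]; first exact: sqr_ge0.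
  by rewrite -natrM natr1 ler_nat.
nra.
Qed.

Lemma energy_shift T (G : sgraph T) (f : T -> R) a :
  energy G (fun x => f x - a) = energy G f.
Proof.
by apply: eq_bigr => x _; apply: eq_bigr => y _; congr (_ ^+ 2); ring.
Qed.

(** Average g(x)^2 <= 2 (g(x) - g(y))^2 + 2 g(y)^2 over the neighbours y of x:
    in a graph of large degree a pointwise value is controlled by L2 norms. *)
Lemma sqr_le_nbr_energy T (G : sgraph T) (g : T -> R) x :
  (degree G x)%:R * g x ^+ 2 <= 2 * energy G g + 2 * \sum_y g y ^+ 2.
Proof.
rewrite -sum_nbr_const.
have : \sum_(y | adj G x y) g x ^+ 2
    <= \sum_(y | adj G x y) (2 * (g x - g y) ^+ 2 + 2 * g y ^+ 2).
  by apply: ler_sum => y _; have := sqr_ge0 (g x - 2 * g y); lra.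
move=> /le_trans; apply; rewrite big_split /= -!mulr_sumr lerD //.
  rewrite ler_pM2l // /energy [leRHS](bigD1 x) //= lerDl.
  by do 2!(apply: sumr_ge0 => ? _); apply: sqr_ge0.
rewrite ler_pM2l // [leRHS](bigID (adj G x)) /= lerDl.
by apply: sumr_ge0 => ? _; apply: sqr_ge0.
Qed.

(** With g = f - mean f, the spectral gap bounds the sum of g^2 by the energy,
    hence e * g(x)^2 <= 4 * energy at every x; f(i) = g(i) - g(j) costs another
    factor 4. *)
Lemma resistance_dense T (G H : sgraph T) d e :
  complementary G H -> (forall x, degree G x = d) ->
  (forall x, degree H x = e) -> (0 < e)%N -> (2 * d < #|T|)%N ->
  resistance_le H (16 / e%:R).
Proof.
move=> GH degG degH e0 small f i j fj.
have eR : 0 < e%:R :> R by rewrite ltr0n.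
pose a := (\sum_x f x) / #|T|%:R; pose g x := f x - a.
have g0 : \sum_x g x = 0.
  rewrite sumrB sumr_const -mulr_natr /a divfK ?subrr // pnatr_eq0 -lt0n.
  exact: leq_ltn_trans small.
have gE x : e%:R * g x ^+ 2 <= 4 * energy H f.
  have := sqr_le_nbr_energy H g x; rewrite degH.
  have := poincare_complementary GH degG small g0; rewrite energy_shift.
  have := energy_ge0 H f; lra.
have fi : f i = g i - g j by rewrite /g fj; ring.
rewrite mulrAC ler_pdivlMr // fi.
have := gE i; have := gE j.
have : 0 <= e%:R * (g i + g j) ^+ 2 by rewrite mulr_ge0 ?sqr_ge0 // ltW.
nra.
Qed.

End Energy.

(** * Resistance along a shortest path *)

Section Geodesic.
Variables (T : finType) (G : sgraph T).

(** [dist] is the graph distance to j; [next] moves one step along a shortest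
    path to j and, since its last property has no side condition, fixes j. *)
Lemma descent_exists (j : T) : (forall x, connect (adj G) x j) ->
  exists (dist : T -> nat) (next : T -> T),
  [/\ forall x, dist x = 0%N -> x = j,
      forall x y, adj G x y -> (dist x <= (dist y).+1)%N,
      forall x, (0 < dist x)%N -> adj G x (next x)
    & forall x, dist (next x) = (dist x).-1].
Proof.
move=> conn.
pose walk x k := [exists w : k.-tuple T, path (adj G) x w && (last x w == j)].
have walkP x p : path (adj G) x p -> last x p = j -> walk x (size p).
  by move=> xp lp; apply/existsP; exists (in_tuple p); rewrite xp lp eqxx.
have ex x : exists k, walk x k.
  by have /connectP[p xp lp] := conn x; exists (size p); exact: walkP.
pose dist x := ex_minn (ex x).
have distP x : walk x (dist x) by rewrite /dist; case: ex_minnP.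
have dist_le x k : walk x k -> (dist x <= k)%N.
  by rewrite /dist; case: ex_minnP => m _ mmin /mmin.
have distj : dist j = 0%N.
  by apply/eqP; rewrite -leqn0 dist_le //; apply: (@walkP j [::]).
have lip x y : adj G x y -> (dist x <= (dist y).+1)%N.
  move=> xy; apply: dist_le.
  have /existsP[w /andP[yw /eqP lw]] := distP y.
  have <- : size (y :: w) = (dist y).+1 by rewrite /= size_tuple.
  by apply: walkP => //=; rewrite xy.
have down x : (0 < dist x)%N -> exists2 y, adj G x y & dist y = (dist x).-1.
  move=> x0; have /existsP[w /andP[xw /eqP lw]] := distP x.
  move: xw lw (size_tuple w); case: (tval w) => [|y p] /=.
    by move=> _ _ s0; rewrite -s0 in x0.
  move=> /andP[xy yp] lp sp; exists y => //; apply/eqP; rewrite eqn_leq.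
  rewrite -sp dist_le ?walkP //= -ltnS sp; exact: lip.
have {}down x : exists y, dist y = (dist x).-1 /\ ((0 < dist x)%N -> adj G x y).
  have [x0|] := posnP (dist x); first by exists x; rewrite x0.
  by move=> /[dup] x0 /down[y xy dy]; exists y.
have [next nextP] := choice down.
exists dist, next; split => // [x x0|x|x]; last by have [] := nextP x.
  have /existsP[w /andP[_ /eqP]] := distP x; rewrite x0 in w *.
  by rewrite tuple0.
by have [] := nextP x.
Qed.

Variables (R : realType) (d : nat).

(** Let l be the distance from i to j.  Telescoping along a shortest path and
    Cauchy-Schwarz give f(i)^2 <= l * energy.  A vertex y is adjacent to at most
    3 vertices of the path, since their distances to j differ from that of y by
    at most 1; summing the degrees along the path gives l * d <= 3 |T|. *)
Lemma resistance_path : connected_graph G ->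
  (forall x, degree G x = d) -> (0 < d)%N ->
  resistance_le G (3 * #|T|%:R / d%:R : R).
Proof.
move=> [_ conn] deg d0 f i j fj.
have [dist [next [dist0 lip adjn distn]]] := descent_exists (conn^~ j).
pose p k := iter k next i; set l := dist i.
have distp k : dist (p k) = (l - k)%N.
  by elim: k => [|k IH]; rewrite ?subn0 // /p iterS distn IH subnS.
have distp_gt0 (k : 'I_l) : (0 < dist (p k))%N by rewrite distp subn_gt0.
have pl : p l = j by apply: dist0; rewrite distp subnn.
have p_inj : injective (fun k : 'I_l => p k).
  move=> a b /(congr1 dist); rewrite !distp => ab; apply: val_inj => /=.
  by have := ltn_ord a; have := ltn_ord b; lia.
have few y : (\sum_(k < l) adj G (p k) y <= 3)%N.
  have -> : (\sum_(k < l) adj G (p k) y = #|[set k : 'I_l | adj G (p k) y]%SET|)%N.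
    by rewrite -sum1dep_card [RHS]big_mkcond; apply: eq_bigr => k _; case: ifP.
  (* dist (p k) - dist y lies in {-1, 0, 1}; g is this difference plus 1. *)
  pose g (k : 'I_l) : 'I_3 := inord ((l - k).+1 - dist y).
  have gP k : adj G (p k) y ->
      ((dist y <= (l - k).+1) && ((l - k).+1 <= (dist y).+2))%N.
    move=> ky; have := lip _ _ ky; have := lip y (p k).
    by rewrite adj_sym ky distp => /(_ isT); lia.
  rewrite -(@card_in_imset _ _ g); last first.
    move=> a b; rewrite !inE => /gP pa /gP pb /(congr1 val).
    rewrite /= !inordK; [|lia|lia] => ab; apply: val_inj => /=.
    by have := ltn_ord a; have := ltn_ord b; lia.
  by rewrite -[leqRHS](card_ord 3) max_card.
have short : (l * d <= 3 * #|T|)%N.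
  have -> : (l * d = \sum_(k < l) \sum_y adj G (p k) y)%N.
    rewrite -[l in LHS]card_ord -sum_nat_const; apply: eq_bigr => k _.
    by rewrite -(deg (p k)) /degree -sum1dep_card big_mkcond; apply: eq_bigr => y _; case: ifP.
  rewrite exchange_big mulnC -sum_nat_const; exact: leq_sum.
have tele : f i = \sum_(k < l) (f (p k) - f (p k.+1)).
  rewrite -[LHS]subr0 -[X in _ - X = _]fj -pl -(big_mkord xpredT (fun k => f (p k) - f (p k.+1))).
  under eq_bigr do rewrite -opprB.
  by rewrite sumrN telescope_sumr // opprB.
have path_energy : \sum_(k < l) (f (p k) - f (p k.+1)) ^+ 2 <= energy G f.
  pose F x := (f x - f (next x)) ^+ 2.
  rewrite -(big_imset F (in2W p_inj)) /energy.
  rewrite [leRHS](bigID (mem [set p k | k : 'I_l])%SET) /= ler_wpDr //.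
    by do 2!(apply: sumr_ge0 => ? _); apply: sqr_ge0.
  apply: ler_sum => x /imsetP[k _ ->].
  rewrite (bigD1 (next (p k))) ?adjn //= lerDl.
  by apply: sumr_ge0 => ? _; apply: sqr_ge0.
have dR : 0 < d%:R :> R by rewrite ltr0n.
rewrite mulrAC ler_pdivlMr // {}tele.
apply: le_trans (ler_wpM2r (ltW dR) (sqr_sum_le _)) _.
rewrite mulrAC -!natrM; apply: ler_pM => //; last by rewrite ler_nat.
by apply: sumr_ge0 => k _; exact: sqr_ge0.
Qed.

End Geodesic.

(** * Hitting times *)

Section HittingTime.
Variables (R : realType) (T : finType) (G : sgraph T).

Lemma big_tupleS k (P : pred (seq T)) (F : seq T -> R) :
  \sum_(w : k.+1.-tuple T | P w) F w
  = \sum_y \sum_(w : k.-tuple T | P (y :: w)) F (y :: w).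
Proof.
rewrite pair_big_dep /= (reindex (fun p : T * k.-tuple T => cons_tuple p.1 p.2)).
  exact: eq_bigl.
exists (fun w => (thead w, behead_tuple w)) => [[y w] _|w _].
  by congr (_, _); apply: val_inj.
by rewrite [RHS]tuple_eta; apply: val_inj.
Qed.

Lemma hit_prob0 x j : hit_prob R G x j 0 = (x == j)%:R.
Proof.
rewrite /hit_prob big_mkcond (big_pred1 [tuple]) => [|w]; last first.
  by apply/esym/eqP/tuple0.
by rewrite /=; case: (x == j).
Qed.

Lemma hit_probS x j k :
  hit_prob R G x j k.+1
  = if x == j then 0 else \sum_y step_prob R G x y * hit_prob R G y j k.
Proof.
rewrite /hit_prob.
rewrite (big_tupleS _ (fun w => index j (x :: w) == k.+1) (traj_prob R G x)) /=.
case: ifP => _; first by rewrite big1 // => y _; rewrite big_pred0.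
apply: eq_bigr => y _; rewrite mulr_sumr.
exact: eq_bigl.
Qed.

Lemma step_prob_ge0 x y : 0 <= step_prob R G x y.
Proof. by rewrite /step_prob divr_ge0. Qed.

Lemma hit_prob_ge0 x j k : 0 <= hit_prob R G x j k.
Proof.
elim: k x => [|k IH] x; first by rewrite hit_prob0.
rewrite hit_probS; case: ifP => // _; apply: sumr_ge0 => y _.
by rewrite mulr_ge0 ?step_prob_ge0.
Qed.

(** P_x(tau_j > k). *)
Definition survival j k x : R := 1 - \sum_(m < k.+1) hit_prob R G x j m.

Lemma survivalS j k x :
  survival j k.+1 x = survival j k x - hit_prob R G x j k.+1.
Proof. by rewrite /survival big_ord_recr opprD addrA. Qed.

(** E_x[min(tau_j, K)].  Unlike the expectation of tau_j itself it is visibly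
    finite, and a bound uniform in K shows that tau_j is almost surely finite
    and bounds its mean. *)
Definition truncated_time j K x : R := \sum_(k < K) survival j k x.

(** Abel summation. *)
Lemma sum_hit_prob_weighted j x K :
  \sum_(k < K.+1) k%:R * hit_prob R G x j k
  = truncated_time j K x - K%:R * survival j K x.
Proof.
rewrite /truncated_time; elim: K => [|K IH].
  by rewrite big_ord1 big_ord0 !mul0r subr0.
rewrite big_ord_recr IH [in RHS]big_ord_recr survivalS /= -natr1; ring.
Qed.

Variable d : nat.
Hypotheses (d_gt0 : (0 < d)%N) (deg : forall x, degree G x = d).

Lemma sum_step_prob x (F : T -> R) :
  \sum_y step_prob R G x y * F y = d%:R^-1 * \sum_(y | adj G x y) F y.
Proof.
rewrite mulr_sumr [RHS]big_mkcond; apply: eq_bigr => y _.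
by rewrite /step_prob deg; case: ifP; rewrite ?mul1r ?mul0r.
Qed.

Let dR : d%:R != 0 :> R.
Proof. by rewrite pnatr_eq0 -lt0n. Qed.

Lemma survival0 j x : survival j 0 x = (x != j)%:R.
Proof. by rewrite /survival big_ord1 hit_prob0; case: eqP; rewrite ?subrr ?subr0. Qed.

Lemma survival_step j k x : survival j k.+1 x =
  if x == j then 0 else \sum_y step_prob R G x y * survival j k y.
Proof.
rewrite /survival big_ord_recl hit_prob0.
under eq_bigr do rewrite lift0 hit_probS.
case: ifP => _; first by rewrite big1 // addr0 subrr.
rewrite add0r exchange_big /=.
under [in RHS]eq_bigr do rewrite mulrBr mulr1 mulr_sumr.
rewrite sumrB; congr (_ - _).
have := sum_step_prob x (fun=> 1); rewrite sum_nbr_const deg mulr1 mulVf //.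
by under eq_bigr do rewrite mulr1.
Qed.

Lemma survival_ge0 j k x : 0 <= survival j k x.
Proof.
elim: k x => [|k IH] x; first by rewrite survival0.
rewrite survival_step; case: ifP => // _; apply: sumr_ge0 => y _.
by rewrite mulr_ge0 ?step_prob_ge0.
Qed.

Lemma survival_nincr j k m x : (k <= m)%N -> survival j m x <= survival j k x.
Proof.
elim: m => [|m IH]; first by rewrite leqn0 => /eqP ->.
rewrite leq_eqVlt => /predU1P[-> //|/IH]; apply: le_trans.
by rewrite survivalS gerBl hit_prob_ge0.
Qed.

Lemma truncated_time_ge0 j K x : 0 <= truncated_time j K x.
Proof. by apply: sumr_ge0 => k _; exact: survival_ge0. Qed.

Lemma truncated_time_target j K : truncated_time j K j = 0.
Proof.
rewrite /truncated_time big1 // => -[[|k] _] _ /=.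
  by rewrite survival0 eqxx.
by rewrite survival_step eqxx.
Qed.

(** Conditioning on the first step gives E_x[min(tau, K+1)] = 1 + the average of
    E_y[min(tau, K)] over the neighbours y of x; the left side is at least
    E_x[min(tau, K)]. *)
Lemma truncated_time_subsolution j K x : x != j ->
  d%:R * truncated_time j K x
  <= d%:R + \sum_(y | adj G x y) truncated_time j K y.
Proof.
move=> xj.
have le_next : truncated_time j K x <= truncated_time j K.+1 x.
  by rewrite /truncated_time big_ord_recr lerDl survival_ge0.
have next : truncated_time j K.+1 x
    = 1 + d%:R^-1 * \sum_(y | adj G x y) truncated_time j K y.
  rewrite {1}/truncated_time big_ord_recl survival0 xj; congr (_ + _).
  under eq_bigr do rewrite lift0 survival_step (negbTE xj) sum_step_prob.
  by rewrite -mulr_sumr exchange_big.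
apply: le_trans (ler_wpM2l (ler0n _ d) le_next) _.
by rewrite next mulrDr mulr1 mulrA divff // mul1r.
Qed.

Lemma truncated_time_le c j K x : connected_graph G -> 0 <= c -> resistance_le G c ->
  truncated_time j K x <= 2 * c * d%:R * #|T|%:R.
Proof.
move=> conn c0 Gc; apply: (subsolution_le deg c0 Gc).
- exact: truncated_time_target.
- by move=> y; exact: truncated_time_ge0.
- by move=> y; exact: truncated_time_subsolution.
Qed.

(** Markov's inequality; [harmonic K] is 1 / (K + 1). *)
Lemma survival_le c j K x : (forall K, truncated_time j K x <= c) ->
  survival j K x <= c * harmonic K.
Proof.
move=> /(_ K.+1) le_c; rewrite ler_pdivlMr ?ltr0n //.
apply: le_trans le_c; rewrite mulr_natr -[X in _ *+ X]card_ord -sumr_const.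
by apply: ler_sum => k _; apply: survival_nincr; rewrite -ltnS.
Qed.

Lemma sum_hit_prob1 c j x : (forall K, truncated_time j K x <= c) ->
  (\sum_(0 <= k <oo) (hit_prob R G x j k)%:E = 1)%E.
Proof.
move=> le_c; apply: cvg_lim => //.
rewrite -(cvg_shiftS _); apply: cvg_EFin.
  by apply: nearW => K; rewrite /= sumEFin.
rewrite (_ : _ \o _ = fun K => 1 - survival j K x); last first.
  by apply/funext => K /=; rewrite sumEFin /= /survival big_mkord subKr.
rewrite -[X in _ --> X]subr0; apply: cvgB; first exact: cvg_cst.
have bound0 : c * harmonic K @[K --> \oo] --> 0.
  by rewrite -[X in _ --> X](mulr0 c); apply: cvgMr; exact: cvg_harmonic.
apply: (squeeze_cvgr _ (cvg_cst 0) bound0).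
by apply: nearW => K; rewrite survival_ge0 survival_le.
Qed.

Lemma mean_hit_time_bound c j x : (forall K, truncated_time j K x <= c) ->
  (0 <= mean_hit_time R G x j <= c%:E)%E.
Proof.
move=> le_c; rewrite /mean_hit_time (sum_hit_prob1 le_c) subee // mule0 adde0.
have ge0 k : (0 <= (k%:R * hit_prob R G x j k)%:E)%E.
  by rewrite lee_fin mulr_ge0 ?hit_prob_ge0.
rewrite nneseries_ge0 //=; apply: lime_le.
  by apply: is_cvg_nneseries => n _ _; exact: ge0.
apply: nearW => -[|K].
  by rewrite big_geq // lee_fin (le_trans _ (le_c 0%N)) ?truncated_time_ge0.
rewrite sumEFin lee_fin big_mkord sum_hit_prob_weighted.
apply: le_trans (le_c K).
by rewrite gerBl mulr_ge0 ?survival_ge0.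
Qed.

End HittingTime.

(** * Kemeny's constant *)

Section Kemeny.
Variables (R : realType) (T : finType) (G : sgraph T) (d : nat).
Hypothesis deg : forall x, degree G x = d.

(** The map (x, y) |-> {x, y} from arcs to edges is at most 2 to 1. *)
Lemma handshake_le : (#|T| * d <= 2 * #|edges G|)%N.
Proof.
have -> : (#|T| * d = #|[set p : T * T | adj G p.1 p.2]%SET|)%N.
  rewrite -sum1dep_card -(pair_big_dep xpredT (adj G) (fun _ _ => 1%N)) /=.
  rewrite -sum_nat_const; apply: eq_bigr => x _.
  by rewrite sum1dep_card -(deg x).
rewrite /edges -sum1_card (partition_big_imset (fun p : T * T => [set p.1; p.2]%SET)) /=.
rewrite mulnC -sum_nat_const; apply: leq_sum => e /imsetP[[a b] _ ->] /=.
rewrite sum1dep_card.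
apply: leq_trans (_ : #|[set (a, b); (b, a)]%SET| <= _)%N; last first.
  by rewrite cards2; case: eqP.
apply: subset_leq_card; apply/fintype.subsetP => -[u v]; rewrite !inE /= => /andP[_].
move=> /eqP/setP E; have := E u; have := E v; have := E a; have := E b.
rewrite !inE !eqxx /= !orbT !xpair_eqE.
rewrite (eq_sym a u) (eq_sym b u) (eq_sym a v) (eq_sym b v).
by case: (u == a); case: (u == b); case: (v == a); case: (v == b).
Qed.

Lemma degree_gt0 (i j : T) : connected_graph G -> i != j -> (0 < d)%N.
Proof.
move=> [_ conn] ij; have /connectP[[|y p] /=] := conn i j.
  by move=> _ ji; rewrite ji eqxx in ij.
move=> /andP[iy _] _; rewrite -(deg i); apply/card_gt0P; exists y.
by rewrite inE.
Qed.

(** All target weights d / (2m) are at most 1 / |T|, so the constant is at most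
    the largest hitting time.  The resistance hypothesis is asked for
    only when d > 0, because on one vertex d = 0 and the sum over the other
    vertices is empty. *)
Lemma kemeny_bound c : connected_graph G -> 0 <= c ->
  ((0 < d)%N -> resistance_le G (c / d%:R)) ->
  (0 <= kemeny R G <= (2 * c * #|T|%:R)%:E)%E.
Proof.
move=> conn c0 Gc; rewrite /kemeny; case: pickP => [i _|_]; last first.
  by rewrite lexx lee_fin !mulr_ge0.
have term j : j != i ->
  (0 <= ((degree G j)%:R / (2 * #|edges G|)%:R)%:E * mean_hit_time R G i j
     <= (2 * c)%:E)%E.
  move=> ji; have d0 := degree_gt0 conn ji.
  have dR : 0 < d%:R :> R by rewrite ltr0n.
  have TR : 0 < #|T|%:R :> R by rewrite ltr0n; case: conn.
  have cd0 : 0 <= c / d%:R by rewrite divr_ge0.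
  have /andP[h0 hle] := mean_hit_time_bound d0 deg
    (fun K => truncated_time_le d0 deg j K i conn cd0 (Gc d0)).
  rewrite mule_ge0 ?lee_fin ?divr_ge0 //=.
  have -> : (2 * c)%:E = ((#|T|%:R^-1)%:E * (2 * c * #|T|%:R)%:E)%E.
    by rewrite -EFinM; congr (_%:E); field; rewrite gt_eqF.
  apply: lee_pmul => //; rewrite ?lee_fin ?divr_ge0 //.
    rewrite deg ler_pdivrMr ?ltr0n; last first.
      by apply: leq_trans handshake_le; rewrite muln_gt0 d0; case: conn => ->.
    rewrite mulrC ler_pdivlMr // -natrM ler_nat mulnC; exact: handshake_le.
  apply: le_trans hle _; rewrite lee_fin.
  by rewrite -(mulrA 2) divfK // gt_eqF.
apply/andP; split; first by apply: sume_ge0 => j /term /andP[].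
apply: (@le_trans _ _ (\sum_(j | j != i) (2 * c)%:E)%E).
  by apply: lee_sum => j /term /andP[].
rewrite sumEFin lee_fin sumr_const -(mulr_natr (2 * c)) ler_wpM2l ?mulr_ge0 //.
by rewrite ler_nat max_card.
Qed.

End Kemeny.

Lemma kemeny_le_regular (R : realType) (T : finType) (G : sgraph T) d :
  (forall x, degree G x = d) -> connected_graph G ->
  (0 <= kemeny R G <= (6 * #|T|%:R ^+ 2)%:E)%E.
Proof.
move=> deg conn.
have -> : 6 * #|T|%:R ^+ 2 = 2 * (3 * #|T|%:R) * #|T|%:R :> R by ring.
apply: (kemeny_bound deg conn); first by rewrite mulr_ge0.
exact: resistance_path.
Qed.

Lemma kemeny_le_dense (R : realType) (T : finType) (G H : sgraph T) d e :
  complementary G H -> (forall x, degree G x = d) ->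
  (forall x, degree H x = e) -> (2 * d < #|T|)%N -> connected_graph H ->
  (0 <= kemeny R H <= (32 * #|T|%:R)%:E)%E.
Proof.
move=> GH degG degH small conn.
have -> : 32 * #|T|%:R = 2 * 16 * #|T|%:R :> R by ring.
apply: (kemeny_bound degH conn) => // e0.
exact: resistance_dense degG degH e0 small.
Qed.

Lemma complementary_sym (T : finType) (G H : sgraph T) :
  complementary G H -> complementary H G.
Proof.
move=> GH x y; rewrite GH; have [->|] /= := eqVneq x y; first exact: adj_irr.
by rewrite negbK.
Qed.

Lemma degree_complementary (T : finType) (G H : sgraph T) x :
  complementary G H -> (degree G x + degree H x).+1 = #|T|.
Proof.
move=> GH; rewrite -(cardC [set y | adj G x y]%SET) -addnS.
congr addn; rewrite /degree [RHS](cardD1 x) !inE adj_irr /=.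
congr _.+1; apply: eq_card => y; rewrite !inE.
by rewrite GH eq_sym.
Qed.

(** The degrees d and e satisfy d + e + 1 = |T|, so 2 d < |T| or 2 e < |T|, and
    by symmetry the former.  The denser graph H then has a constant of order
    |T|, while that of G is of order at most |T|^2. *)
Lemma kemeny_product_le (R : realType) (T : finType) (G H : sgraph T) d e :
  complementary G H -> (forall x, degree G x = d) ->
  (forall x, degree H x = e) -> connected_graph G -> connected_graph H ->
  (0 <= kemeny R G * kemeny R H <= (192 * #|T|%:R ^+ 3)%:E)%E.
Proof.
move=> + + + connG connH.
wlog : G H d e connG connH / (2 * d < #|T|)%N => [sparse|small] GH degG degH.
  have [dense|] := ltnP (2 * d) #|T|; first exact: (sparse G H d e).
  move=> dense; rewrite muleC; apply: (sparse H G e d) => //.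
    have /card_gt0P[x _] : (0 < #|T|)%N by case: connG.
    by have := degree_complementary x GH; rewrite degG degH; lia.
  exact: complementary_sym.
have /andP[G0 Gle] := kemeny_le_regular R degG connG.
have /andP[H0 Hle] := kemeny_le_dense R GH degG degH small connH.
rewrite mule_ge0 //=; apply: le_trans (lee_pmul G0 H0 Gle Hle) _.
by rewrite -EFinM lee_fin le_eqVlt; apply/orP; left; apply/eqP; ring.
Qed.

(** Infiniteness of N keeps the limsup from being that of the trivial filter,
    which would be -oo. *)
Lemma bigO_along_bounded (R : realType) (N : set nat)
    (f : nat -> \bar R) (g : nat -> R) (c : R) :
  infinite_set N -> (forall n, N n -> 0 < g n) ->
  (forall n, N n -> (0 <= f n <= (c * g n)%:E)%E) -> bigO_along N f g.
Proof.
move=> N_inf g0 fle; rewrite /bigO_along limf_esupE.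
pose h n := (f n * ((g n)^-1)%:E)%E; rewrite -/h.
have hP n : N n -> (0 <= h n <= c%:E)%E.
  move=> Nn; have /andP[f0 fc] := fle n Nn; have gn := g0 n Nn.
  rewrite lee_pdivrMr // -EFinM fc andbT mule_ge0 // lee_fin invr_ge0.
  exact: ltW.
rewrite fin_numElt; apply/andP; split.
  apply: (@lt_le_trans _ _ 0%E); first exact: ltNy0.
  apply: le_ereal_inf_tmp => /= _ [A NA <-].
  have [m _ mA] := NA; suff [n Nn mn] : exists2 n, N n & (m <= n)%N.
    apply: le_ereal_sup_tmp; exists (h n); first by exists n => //; exact: mA.
    by have /andP[] := hP n Nn.
  apply: contrapT => bounded; apply: N_inf; apply: sub_finite_set (finite_II m).
  move=> n Nn /=; rewrite ltnNge; apply/negP => mn; apply: bounded.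
  by exists n.
apply: (@le_lt_trans _ _ c%:E); last exact: ltry.
apply: ge_ereal_inf; exists (ereal_sup (h @` N)).
  exists N => //; exact: withinT.
by apply: ge_ereal_sup => _ [n Nn <-]; have /andP[] := hP n Nn.
Qed.

Theorem mainTheorem5 (R : realType) (N : set nat)
    (G : forall n : nat, sgraph 'I_n)
    (N_pos : forall n, N n -> (0 < n)%N)
    (N_inf : infinite_set N)
    (G_reg : forall n, N n -> regular_graph (G n))
    (G_conn : forall n, N n -> connected_graph (G n))
    (Gc_conn : forall n, N n -> connected_graph (complement (G n))) :
  bigO_along N
    (fun n => (kemeny R (G n) * kemeny R (complement (G n)))%E)
    (fun n => n%:R ^+ 3).
Proof.
apply: (@bigO_along_bounded _ _ _ _ 192) => // n Nn.
  by rewrite exprn_gt0 // ltr0n N_pos.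
have [d degG] := G_reg n Nn.
have GH : complementary (G n) (complement (G n)) by [].
have degH x : degree (complement (G n)) x = (n.-1 - d)%N.
  have := degree_complementary x GH; rewrite card_ord degG; lia.
have := kemeny_product_le R GH degG degH (G_conn n Nn) (Gc_conn n Nn).
by rewrite card_ord.
Qed.
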